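(* Let $K$ be a field and let $T^*_K$ be any one of $T_K$, $T_K^s$, $T_K^a$. In $T^*_K$ all types are determined by their quantifier-free part: for all e.c. models $M,N$ of $T^*_K$ and all tuples $\bar a\in M$, $\bar b\in N$ of the same (possibly infinite) length, if $\mathrm{qftp}(\bar a)=\mathrm{qftp}(\bar b)$ then $\mathrm{tp}(\bar a)=\mathrm{tp}(\bar b)$.
   Context: A $K$-bilinear space is a $K$-vector space $V$ with a map $[\cdot,\cdot]:V\times V\to K$ linear in each argument; it is symmetric if $[x,y]=[y,x]$ for all $x,y$, and alternating if $[x,x]=0$ for all $x$. Positive logic: a (positive existential) formula is built from atomic formulas using $\wedge,\vee,\top,\bot,\exists$. An h-inductive sentence has the form $\forall\bar x(\varphi(\bar x)\to\psi(\bar x))$ with $\varphi,\psi$ such formulas; a (positive) theory is a set of h-inductive sentences. A homomorphism is a function between structures preserving truth of formulas; it is an immersion if it also reflects truth of formulas. A model $M$ of $T$ is existentially closed (e.c.) if every homomorphism $f:M\to N$ with $N\models T$ is an immersion. For $\bar a$ in an e.c. model $M$, $\mathrm{tp}(\bar a)$ is the set of all formulas without parameters true of $\bar a$ in $M$, and $\mathrm{qftp}(\bar a)$ is its subset of quantifier-free formulas. $\mathcal L_K$ is the standard signature of $K$-vector spaces, with a unary function symbol for multiplication by each $\lambda\in K$, a relation symbol $\neq$ for inequality, and for every $\lambda\in K$ a binary relation symbol written $[x,y]=\lambda$, expressing that the bilinear product of $x$ and $y$ is $\lambda$. Every $K$-bilinear space is naturally viewed as an $\mathcal L_K$-structure.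 $T_K$, $T_K^s$, $T_K^a$ are the sets of all h-inductive $\mathcal L_K$-sentences true in all $K$-bilinear spaces, all symmetric $K$-bilinear spaces, and all alternating $K$-bilinear spaces, respectively. *)

(* Defs.v *)
From HB Require Import structures.
From mathcomp Require Import all_boot all_algebra sesquilinear.
From mathcomp Require Import classical_sets.

Set Implicit Arguments.
Unset Strict Implicit.
Unset Printing Implicit Defensive.

Import GRing.Theory.
Local Open Scope ring_scope.

Record signature := Signature {
  fun_symb : Type;
  fun_arity : fun_symb -> nat;
  rel_symb : Type;
  rel_arity : rel_symb -> nat }.

Section PositiveLogic.
Variable L : signature.

(* The variables of terms and formulas are drawn from an arbitrary type, so
   that the types of infinite tuples are covered. *)
Inductive term (X : Type) : Type :=
  | Var of X
  | App (f : fun_symb L) of ('I_(fun_arity f) -> term X).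

(* Equality is a logical symbol.  In [Exist p] the bound variable is [None],
   and [Some x] is the outer variable x. *)
Inductive formula (X : Type) : Type :=
  | Top
  | Bot
  | Equal of term X & term X
  | Rel (r : rel_symb L) of ('I_(rel_arity r) -> term X)
  | And of formula X & formula X
  | Or of formula X & formula X
  | Exist of formula (option X).

Fixpoint quantifier_free (X : Type) (p : formula X) : bool :=
  match p with
  | Top | Bot | Equal _ _ | Rel _ _ => true
  | And p q | Or p q => quantifier_free p && quantifier_free q
  | Exist _ => false
  end.

Record structure := Structure {
  domain :> Type;
  fun_interp (f : fun_symb L) : ('I_(fun_arity f) -> domain) -> domain;
  rel_interp (r : rel_symb L) : ('I_(rel_arity r) -> domain) -> Prop }.

Fixpoint eval (M : structure) (X : Type) (a : X -> M) (t : term X) : M :=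
  match t with
  | Var x => a x
  | App f ts => fun_interp (fun i => eval a (ts i))
  end.

Definition extend (T X : Type) (a : X -> T) (m : T) (o : option X) : T :=
  if o is Some x then a x else m.

Fixpoint sat (M : structure) (X : Type) (a : X -> M) (p : formula X) : Prop :=
  match p with
  | Top => True
  | Bot => False
  | Equal t u => eval a t = eval a u
  | Rel r ts => rel_interp (fun i => eval a (ts i))
  | And p q => sat a p /\ sat a q
  | Or p q => sat a p \/ sat a q
  | Exist p => exists m : M, sat (extend a m) p
  end.

Record sentence := HInductive {
  nvars : nat;
  premise : formula 'I_nvars;
  conclusion : formula 'I_nvars }.

Definition holds (M : structure) (s : sentence) : Prop :=
  forall a : 'I_(nvars s) -> M, sat a (premise s) -> sat a (conclusion s).

Definition theory := set sentence.

Definition model (T : theory) (M : structure) : Prop :=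
  forall s, T s -> holds M s.

Definition homomorphism (M N : structure) (h : M -> N) : Prop :=
  forall (n : nat) (p : formula 'I_n) (a : 'I_n -> M),
    sat a p -> sat (h \o a) p.

Definition immersion (M N : structure) (h : M -> N) : Prop :=
  homomorphism h /\
  forall (n : nat) (p : formula 'I_n) (a : 'I_n -> M),
    sat (h \o a) p -> sat a p.

Definition existentially_closed (T : theory) (M : structure) : Prop :=
  model T M /\
  forall (N : structure) (h : M -> N),
    model T N -> homomorphism h -> immersion h.

Definition tp (M : structure) (X : Type) (a : X -> M) : set (formula X) :=
  [set p | sat a p]%classic.

Definition qftp (M : structure) (X : Type) (a : X -> M) : set (formula X) :=
  [set p | tp a p /\ quantifier_free p]%classic.

End PositiveLogic.

Section BilinearSpaces.
Variable K : fieldType.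

Record bilinear_space := BilinearSpace {
  vectors :> lmodType K;
  product : {biscalar vectors} }.

Definition symmetric_space (V : bilinear_space) : Prop :=
  forall x y : V, product V x y = product V y x.

Definition alternating_space (V : bilinear_space) : Prop :=
  forall x : V, product V x x = 0.

Inductive LK_func := LKzero | LKadd | LKopp | LKscale of K.

Definition LK_fun_arity (f : LK_func) : nat :=
  match f with LKzero => 0 | LKadd => 2 | LKopp | LKscale _ => 1 end.

Inductive LK_rel := LKneq | LKform of K.

Definition LK_rel_arity (r : LK_rel) : nat := 2.

Definition LK : signature := Signature LK_fun_arity LK_rel_arity.

Definition LK_fun_interp (V : bilinear_space) (f : LK_func) :
    ('I_(LK_fun_arity f) -> V) -> V :=
  match f return ('I_(LK_fun_arity f) -> V) -> V with
  | LKzero => fun _ => 0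
  | LKadd => fun v => v ord0 + v ord_max
  | LKopp => fun v => - v ord0
  | LKscale l => fun v => l *: v ord0
  end.

Definition LK_rel_interp (V : bilinear_space) (r : LK_rel) :
    ('I_(LK_rel_arity r) -> V) -> Prop :=
  match r return ('I_(LK_rel_arity r) -> V) -> Prop with
  | LKneq => fun v => v ord0 <> v ord_max
  | LKform l => fun v => product V (v ord0) (v ord_max) = l
  end.

(* A general LK-structure, even a model of one of the theories below, need not
   be of this form: the product of two elements may have no value in K. *)
Definition space_structure (V : bilinear_space) : structure LK :=
  @Structure LK V (@LK_fun_interp V) (@LK_rel_interp V).

Definition TK : theory LK :=
  [set s | forall V : bilinear_space, holds (space_structure V) s]%classic.

Definition TKs : theory LK :=
  [set s | forall V : bilinear_space,
     symmetric_space V -> holds (space_structure V) s]%classic.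

Definition TKa : theory LK :=
  [set s | forall V : bilinear_space,
     alternating_space V -> holds (space_structure V) s]%classic.

End BilinearSpaces.

Arguments TK K _ : clear implicits.
Arguments TKs K _ : clear implicits.
Arguments TKa K _ : clear implicits.

(* Main.v *)
Require Import Defs.
From HB Require Import structures.
From mathcomp Require Import all_boot all_algebra sesquilinear ring.
From mathcomp Require Import boolp classical_sets functions.

(** The proof is an amalgamation argument.

    First, every existentially closed model is a genuine bilinear space
    ([ec_space]).  A model of the theory satisfies the vector space axioms, so
    it is a vector space V on which some products [x,y] may have no value.  The
    defined values extend to a total form on V of the same kind
    ([model_form]).  Granting this, the identity is a homomorphism from the
    model to a space, hence an immersion, hence reflects each [x,y] = l, and
    every product was defined from the start.

    To extend a partial form, let F be the set of all total forms on V of the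
    given kind and send x, y to the evaluation function B |-> B(x,y) in K^F.
    This is bilinear in x, y, and symmetric or alternating if the forms in F
    are, so it suffices to find a linear functional phi on K^F that takes the
    value l at each evaluation whose [x,y] = l is prescribed; the form
    phi(evaluation x y) is then of the required kind.  The values that the
    prescribed products force on elements of K^F form a linear relation, and phi
    exists as soon as 0 is forced to no value but 0.  Only finitely many facts
    about the model are involved in forcing a value.  If they forced 0 to a
    nonzero value, they would be inconsistent with every space W: whenever W
    realises them, the realisation extends to a linear map V -> W
    ([finite_presentation]), and pulling back the form of W gives an element of
    F, where the function 0 takes the value 0.  The inconsistency is an
    h-inductive sentence of the theory, refuted by the model.

    Secondly, let V and W be e.c. spaces with tuples a and b of the same
    quantifier-free type.  Sending t(a) to t(b), for t a term, is a well-defined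
    isometry between the subspaces A and B that the tuples span.  Write
    V = A + V' with V' a complement of A.  Identifying A with B, the spaces V
    and W embed over it in V' + W, with V' and a complement of B made
    orthogonal ([amalgam]).  Both embeddings preserve positive formulas,
    and the embedding of W is an immersion, so tp(a) is contained in tp(b).

    The linear algebra rests on one consequence of Zorn's lemma: a partial linear
    map extends to a total one that takes no new values ([linear_extension]). *)

Set Implicit Arguments.
Unset Strict Implicit.
Unset Printing Implicit Defensive.

Import GRing.Theory.
Local Open Scope ring_scope.

(** * Formulas with arbitrarily many variables *)

Section Logic.
Variable L : signature.

Fixpoint rename_term (X Y : Type) (r : X -> Y) (t : term L X) : term L Y :=
  match t with
  | Var x => Var L (r x)
  | App f ts => App (fun i => rename_term r (ts i))
  end.

Fixpoint rename (X Y : Type) (r : X -> Y) (p : formula L X) : formula L Y :=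
  match p with
  | Top => Top L Y
  | Bot => Bot L Y
  | Equal t u => Equal (rename_term r t) (rename_term r u)
  | Rel R ts => Rel (fun i => rename_term r (ts i))
  | And p q => And (rename r p) (rename r q)
  | Or p q => Or (rename r p) (rename r q)
  | Exist p => Exist (rename (omap r) p)
  end.

Lemma eval_rename (M : structure L) (X Y : Type) (r : X -> Y) (a : Y -> M) t :
  eval a (rename_term r t) = eval (a \o r) t.
Proof.
elim: t => [//|f ts IH] /=; congr fun_interp.
by apply: funext => i; apply: IH.
Qed.

Lemma sat_rename (M : structure L) (X Y : Type) (r : X -> Y) (a : Y -> M) p :
  sat a (rename r p) = sat (a \o r) p.
Proof.
elim: p Y r a => {X} [X|X|X t u|X R ts|X p IHp q IHq|X p IHp q IHq|X p IH] //=
  Y r a.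
- by rewrite !eval_rename.
- by congr rel_interp; apply: funext => i; rewrite eval_rename.
- by rewrite IHp IHq.
- by rewrite IHp IHq.
- congr ex; apply: funext => m; rewrite IH.
  by congr (sat _ p); apply: funext; case.
Qed.

(** A finite family of variables.  The entries are optional so that the family
    of a quantified formula can be obtained from that of its body by erasing the
    bound variable, even when no other variable is available. *)
Record support (X : Type) := Support {
  entries : finType;
  entry : entries -> option X }.
Arguments entry {X} s i.

Definition agree (X T : Type) (S : support X) (a b : X -> T) : Prop :=
  forall i x, entry S i = Some x -> a x = b x.

Definition support_join (X : Type) (S S' : support X) : support X :=
  @Support X (entries S + entries S')%type
    (fun k => match k with inl i => entry S i | inr i => entry S' i end).

Lemma agree_join (X T : Type) (S S' : support X) (a b : X -> T) :
  agree (support_join S S') a b -> agree S a b /\ agree S' a b.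
Proof.
move=> ab; split=> i x Si; [exact: (ab (inl i))|exact: (ab (inr i))].
Qed.

Lemma term_support (X : Type) (t : term L X) :
  exists S : support X, forall (M : structure L) (a b : X -> M),
    agree S a b -> eval a t = eval b t.
Proof.
elim: t => [x|f ts /choice[S IH]].
  by exists (@Support X unit (fun _ => Some x)) => M a b ab; exact: (ab tt).
exists (@Support X {i & entries (S i)}
          (fun k => entry (S (tag k)) (tagged k))).
move=> M a b ab /=; congr fun_interp; apply: funext => i; apply: IH => j x.
exact: (ab (Tagged (fun i => entries (S i)) j)).
Qed.

Lemma formula_support (X : Type) (p : formula L X) :
  exists S : support X, forall (M : structure L) (a b : X -> M),
    agree S a b -> sat a p -> sat b p.
Proof.
elim: p => {X} [X|X|X t u|X R ts|X p [S IHp] q [S' IHq]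
               |X p [S IHp] q [S' IHq]|X p [S IH]].
- by exists (@Support X void (fun _ => None)).
- by exists (@Support X void (fun _ => None)).
- have [[S IHt] [S' IHu]] := (term_support t, term_support u).
  exists (support_join S S') => M a b /agree_join[ab ab'] /=.
  by rewrite (IHt _ _ _ ab) (IHu _ _ _ ab').
- have /choice[S IH] := fun i => term_support (ts i).
  exists (@Support X {i & entries (S i)}
            (fun k => entry (S (tag k)) (tagged k))).
  move=> M a b ab /=; congr rel_interp; apply: funext => i; apply: IH => j x.
  exact: (ab (Tagged (fun i => entries (S i)) j)).
- exists (support_join S S') => M a b /agree_join[ab ab'] /= [pa qa].
  by split; [exact: IHp ab pa|exact: IHq ab' qa].
- exists (support_join S S') => M a b /agree_join[ab ab'] /= [pa|qa].
    by left; exact: IHp ab pa.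
  by right; exact: IHq ab' qa.
- exists (@Support X (entries S) (fun i => obind id (entry S i))).
  move=> M a b ab [m pa]; exists m; apply: IH pa => i [x|] //= Si.
  by apply: (ab i); rewrite /= Si.
Qed.

Lemma support_retract (X : Type) (S : support X) :
  exists (n : nat) (r : X -> 'I_n) (s : 'I_n -> X),
    forall (T : Type) (a : X -> T), agree S a (a \o s \o r).
Proof.
case: (pselect (inhabited X)) => [[x0]|noX]; last first.
  exists 0%N, (fun x => False_rect _ (noX (inhabits x))).
  have s (i : 'I_0) : X by case: i.
  by exists s => T a i x; case: (noX (inhabits x)).
(* The additional index None receives the variables outside the support. *)
pose r x : 'I_#|{: option (entries S)}| := enum_rank
  (if pselect (exists i, entry S i = Some x) is left h
   then Some (sval (cid h)) else None).
pose s (j : 'I_#|{: option (entries S)}|) :=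
  if enum_val j is Some i then odflt x0 (entry S i) else x0.
exists _, r, s => T a i x Si /=; rewrite /s /r enum_rankK.
by case: pselect => [h|[]]; [case: cid => k /= ->|exists i].
Qed.

(** Sentences, homomorphisms and immersions are defined with the finite variable
    types 'I_n; this reduces formulas over any type of variables to those. *)
Lemma finitely_many_variables (X : Type) (p q : formula L X) :
  exists (n : nat) (r : X -> 'I_n) (s : 'I_n -> X),
    forall (M : structure L) (a : X -> M),
      (sat a p <-> sat (a \o s \o r) p) /\ (sat a q <-> sat (a \o s \o r) q).
Proof.
have [[S Sp] [S' Sq]] := (formula_support p, formula_support q).
have [n [r [s rs]]] := support_retract (support_join S S').
exists n, r, s => M a; have /agree_join[ap aq] := rs M a.
split; split.
- exact: Sp ap.
- by apply: Sp => i x /ap ->.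
- exact: Sq aq.
- by apply: Sq => i x /aq ->.
Qed.

Lemma immersion_reflects (M N : structure L) (h : M -> N) :
  immersion h -> forall (X : Type) (p : formula L X) (a : X -> M),
    sat (h \o a) p -> sat a p.
Proof.
move=> [_ refl] X p a; have [n [r [s rs]]] := finitely_many_variables p p.
move=> /(rs N _).1; rewrite -(sat_rename r (h \o a \o s)) => /refl.
by rewrite sat_rename => pa; apply: ((rs M a).1).2 pa.
Qed.

(** Any type of variables is allowed here, in particular the elements of the
    model itself, with the identity as assignment.  This makes it possible to
    work with diagrams of models instead of numbered variables. *)
Lemma model_entails (J : Type) (C : J -> Prop) (S : J -> structure L)
    (M : structure L) :
  model [set s | forall j, C j -> holds (S j) s]%classic M ->
  forall (X : Type) (p q : formula L X),
    (forall j, C j -> forall a : X -> S j, sat a p -> sat a q) ->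
    forall a : X -> M, sat a p -> sat a q.
Proof.
move=> TM X p q pq a; have [n [r [s rs]]] := finitely_many_variables p q.
move=> /(rs M a).1; rewrite -(sat_rename r (a \o s)) => pa.
apply/(rs M a).2; rewrite -(sat_rename r (a \o s)).
apply: (TM (HInductive (rename r p) (rename r q))) pa => j Cj b /=.
by rewrite !sat_rename; apply: pq.
Qed.

Lemma eval_commutes (M N : structure L) (h : M -> N) :
  (forall f (v : 'I_(fun_arity f) -> M),
     h (fun_interp v) = fun_interp (h \o v)) ->
  forall (X : Type) (a : X -> M) (t : term L X),
    eval (h \o a) t = h (eval a t).
Proof.
move=> hf X a; elim=> //= f ts IH; rewrite hf; congr fun_interp.
exact: funext.
Qed.

Lemma preserves_positive (M N : structure L) (h : M -> N) :
  (forall f (v : 'I_(fun_arity f) -> M),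
     h (fun_interp v) = fun_interp (h \o v)) ->
  (forall r (v : 'I_(rel_arity r) -> M),
     rel_interp v -> rel_interp (h \o v)) ->
  forall (X : Type) (p : formula L X) (a : X -> M), sat a p -> sat (h \o a) p.
Proof.
move=> hf hr X p; have ht := eval_commutes hf.
elim: p => {X} [X|X|X t u|X R ts|X p IHp q IHq|X p IHp q IHq|X p IH] a //=.
- by rewrite !ht => ->.
- by move=> /hr; congr rel_interp; apply: funext => i; rewrite ht.
- by move=> [/IHp ? /IHq ?].
- by move=> [/IHp ?|/IHq ?]; [left|right].
- move=> [m /IH pm]; exists (h m); move: pm.
  by congr (sat _ p); apply: funext; case.
Qed.

End Logic.

(** * Extension of partial linear maps *)

Section LinearRelations.
Variables (K : fieldType) (U W : lmodType K).
Implicit Types G H : U -> W -> Prop.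

Definition linear_relation G : Prop :=
  G 0 0 /\
  forall c x y x' y', G x y -> G x' y' -> G (c *: x + x') (c *: y + y').

(** For a linear relation, this is equivalent to being the graph of a partial
    map. *)
Definition single_valued G : Prop := forall y, G 0 y -> y = 0.

Lemma linear_relation_unique G x y y' :
  linear_relation G -> single_valued G -> G x y -> G x y' -> y = y'.
Proof.
move=> [_ Glin] Gsv Gy Gy'; have := Glin (-1) _ _ _ _ Gy Gy'.
by rewrite !scaleN1r addNr => /Gsv/eqP; rewrite addrC subr_eq0 eq_sym => /eqP.
Qed.

(** Zorn's lemma is applied to the sets of pairs that may be added to G, rather
    than to the relations that contain G, because the empty chain must have an
    upper bound.  At a point outside the domain of a maximal relation the value
    0 could be added, which would keep the range unchanged. *)
Lemma extend_linear_relation G :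
  linear_relation G -> single_valued G ->
  exists H, [/\ linear_relation H, single_valued H,
    (forall x y, H x y -> exists x', G x' y),
    (forall x y, G x y -> H x y) & forall x, exists y, H x y].
Proof.
move=> Glin Gsv; pose adj (A : set (U * W)) x y := G x y \/ A (x, y).
pose P (A : set (U * W)) := [/\ linear_relation (adj A), single_valued (adj A)
  & forall x y, adj A x y -> exists x', G x' y].
have P0 : P set0.
  rewrite /P; suff -> : adj set0 = G by split=> // x y Gxy; exists x.
  by apply: funext => x; apply: funext => y; apply/propext; split=> [[]|] //; left.
case: (@Zorn_bigcup _ P) => [F FP Ftot|A [[Alin Asv Arng] Amax]].
  have up (p q : U * W) : adj (\bigcup_(X in F) X)%classic p.1 p.2 ->
      adj (\bigcup_(X in F) X)%classic q.1 q.2 ->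
      exists A, [/\ P A, A `<=` \bigcup_(X in F) X,
                    adj A p.1 p.2 & adj A q.1 q.2]%classic.
    case: p q => [x y] [x' y'] [Gp|[A FA Ap]] [Gq|[B FB Bq]] /=.
    - by exists set0; split; [exact: P0|move=> ? []|left|left].
    - by exists B; split; [exact: FP|exact: bigcup_sup|left|right].
    - by exists A; split; [exact: FP|exact: bigcup_sup|right|left].
    - case: (Ftot A B FA FB) => [AB|BA].
        by exists B; split; [exact: FP|exact: bigcup_sup|right; exact: AB|right].
      by exists A; split; [exact: FP|exact: bigcup_sup|right|right; exact: BA].
  have mono (A B : set (U * W)) x y :
      (A `<=` B)%classic -> adj A x y -> adj B x y.
    by move=> AB [|/AB]; [left|right].
  split.
  - split=> [|c x y x' y' pxy qxy]; first by left; case: Glin.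
    have [A [[[_ Alin] _ _] AF Ap Aq]] := up (x, y) (x', y') pxy qxy.
    exact/(mono A)/Alin.
  - move=> y py; have [A [[_ Asv _] _ Ap _]] := up (0, y) (0, y) py py.
    exact: Asv.
  - move=> x y py; have [A [[_ _ Arng] _ Ap _]] := up (x, y) (x, y) py py.
    exact: Arng Ap.
exists (adj A); split=> // [x y|x0]; first by left.
apply: contrapT => nx0.
pose B := [set p : U * W |
            exists c z, p.1 = z + c *: x0 /\ adj A z p.2]%classic.
have AB x y : adj A x y -> B (x, y).
  by move=> Axy; exists 0, x; rewrite scale0r addr0.
have adjB : adj B = fun x y => B (x, y).
  apply: funext => x; apply: funext => y; apply/propext; split; last by right.
  by move=> [Gxy|//]; apply: AB; left.
apply: (Amax B).
  split=> [[x y] Axy|BA]; first by apply: AB; right.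
  apply: nx0; exists 0; right; apply: BA; exists 1, 0.
  by rewrite add0r scale1r; split=> //; case: Alin.
rewrite /P adjB; split.
- split; first by apply: AB; case: Alin.
  move=> c x y x' y' [d [z [/= -> Az]]] [d' [z' [/= -> Az']]].
  exists (c * d + d'), (c *: z + z'); split; last exact: Alin.2.
  by rewrite /= scalerDr scalerDl scalerA addrACA.
- move=> y [c [z [/= z0 Az]]]; have [c0|c0] := eqVneq c 0.
    by apply: Asv; move: z0; rewrite c0 scale0r addr0 => ->.
  case: nx0; exists (- c^-1 *: y + 0).
  have -> : x0 = - c^-1 *: z + 0.
    have /eqP : z = - (c *: x0) by apply/eqP; rewrite -subr_eq0 opprK -z0.
    by move=> /eqP ->; rewrite addr0 scalerN scaleNr opprK scalerA mulVf ?scale1r.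
  by apply: Alin.2 => //; case: Alin.
- by move=> x y [c [z [_ /Arng]]].
Qed.

Definition linear_map (f : U -> W) (flin : linear f) : {linear U -> W} :=
  HB.pack f (GRing.isLinear.Build K U W _ f flin).

(** That the extension takes no new values is what makes it a projection onto a
    subspace when G is the identity of that subspace. *)
Lemma linear_extension G :
  linear_relation G -> single_valued G ->
  exists f : {linear U -> W},
    (forall x y, G x y -> f x = y) /\ (forall x, exists x', G x' (f x)).
Proof.
move=> Glin Gsv; have [H [Hlin Hsv Hrng GH /choice[f Hf]]] :=
  extend_linear_relation Glin Gsv.
have flin : linear f.
  move=> c x y; apply: linear_relation_unique (Hf _) _ => //.
  exact: Hlin.2.
exists (linear_map flin); split=> [x y /GH Hxy|x]; last exact: Hrng (Hf x).
exact: linear_relation_unique (Hf x) Hxy.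
Qed.

End LinearRelations.

Definition bilinear_form (K : fieldType) (V : lmodType K) (B : V -> V -> K)
    (Blin : bilinear_for *%R *%R B) : {biscalar V} :=
  HB.pack B (@bilinear_isBilinear.Build K V V K *%R *%R B Blin).

(** * Vector spaces with binary relations, and their terms *)

Section Terms.
Variable K : fieldType.

Definition pair_of (T : Type) (x y : T) : 'I_2 -> T :=
  fun i => if i == ord0 then x else y.

Lemma pair_of_eta (T : Type) (v : 'I_2 -> T) : v = pair_of (v ord0) (v ord_max).
Proof.
apply: funext; case=> [[|[|//]] i]; rewrite /pair_of /=; congr v;
  exact: val_inj.
Qed.

Section Constructors.
Variable X : Type.
Implicit Types t u : term (LK K) X.

Definition tzero : term (LK K) X :=
  @App (LK K) X (LKzero K) (fun i => match notF (ltn_ord i) with end).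
Definition tadd t u : term (LK K) X := @App (LK K) X (LKadd K) (pair_of t u).
Definition topp t : term (LK K) X := @App (LK K) X (LKopp K) (fun=> t).
Definition tscale c t : term (LK K) X := @App (LK K) X (LKscale c) (fun=> t).
Definition atom (r : LK_rel K) t u : formula (LK K) X :=
  @Rel (LK K) X r (pair_of t u).

End Constructors.

Definition vector_interp (V : lmodType K) (f : LK_func K) :
    ('I_(LK_fun_arity f) -> V) -> V :=
  match f return ('I_(LK_fun_arity f) -> V) -> V with
  | LKzero => fun _ => 0
  | LKadd => fun v => v ord0 + v ord_max
  | LKopp => fun v => - v ord0
  | LKscale l => fun v => l *: v ord0
  end.

(** The shape of an arbitrary model: the function symbols are interpreted as in
    a vector space, but the relations need not come from a form. *)
Definition vector_structure (V : lmodType K) (R : LK_rel K -> ('I_2 -> V) -> Prop) :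
    structure (LK K) :=
  @Structure (LK K) V (@vector_interp V) R.

End Terms.

(** * Models of the theories of bilinear spaces *)

Section Spaces.
Variables (K : fieldType) (sym alt : bool).

(** The two flags treat the general, symmetric and alternating cases at once. *)
Definition space_class (V : bilinear_space K) : Prop :=
  (sym -> symmetric_space V) /\ (alt -> alternating_space V).

Definition spaces_theory : theory (LK K) :=
  [set s | forall V, space_class V -> holds (space_structure V) s]%classic.

Lemma space_model V : space_class V -> model spaces_theory (space_structure V).
Proof. by move=> CV s; apply. Qed.

(** Each vector space axiom is an equation between two terms whose variables are
    elements of the model; it is true in all spaces, hence in the model. *)
Lemma model_vector_space (M : structure (LK K)) : model spaces_theory M ->
  exists V R, M = @vector_structure K V R.
Proof.
move=> TM.
have law (t u : term (LK K) M) :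
    (forall V, space_class V -> forall a : M -> V,
      eval (M := space_structure V) a t = eval (M := space_structure V) a u) ->
    eval (M := M) id t = eval (M := M) id u.
  move=> tu; apply: (model_entails TM (p := Top _ _) (q := Equal t u)) => //=.
  by move=> V CV a _; apply: tu.
pose add (x y : M) := eval (M := M) id (tadd (Var (LK K) x) (Var (LK K) y)).
pose opp (x : M) := eval (M := M) id (topp (Var (LK K) x)).
pose scale c (x : M) := eval (M := M) id (tscale c (Var (LK K) x)).
pose zero := eval (M := M) id (tzero K M).
have addE t u : eval (M := M) id (tadd t u) = add (eval id t) (eval id u).
  rewrite /add /=; congr fun_interp; apply: funext => i.
  by rewrite /pair_of; case: eqP.
have addA : associative add.
  move=> x y z; have := law (tadd (Var _ x) (tadd (Var _ y) (Var _ z)))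
    (tadd (tadd (Var _ x) (Var _ y)) (Var _ z)).
  by rewrite !addE /=; apply=> V _ a /=; rewrite /= addrA.
have addC : commutative add.
  by move=> x y; apply: law => V _ a /=; rewrite addrC.
have add0 : left_id zero add.
  move=> x; have := law (tadd (tzero K M) (Var _ x)) (Var _ x).
  by rewrite !addE; apply=> V _ a /=; rewrite add0r.
have addN : left_inverse zero opp add.
  move=> x; have := law (tadd (topp (Var _ x)) (Var _ x)) (tzero K M).
  by rewrite !addE; apply=> V _ a /=; rewrite addNr.
have scaleA c d x : scale c (scale d x) = scale (c * d) x.
  have := law (tscale c (tscale d (Var _ x))) (tscale (c * d) (Var _ x)).
  by apply=> V _ a /=; rewrite scalerA.
have scale1 : left_id 1 scale.
  by move=> x; apply: (law _ (Var _ x)) => V _ a /=; rewrite scale1r.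
have scaleD : right_distributive scale add.
  move=> c x y; have := law (tscale c (tadd (Var _ x) (Var _ y)))
    (tadd (tscale c (Var _ x)) (tscale c (Var _ y))).
  by rewrite !addE; apply=> V _ a /=; rewrite scalerDr.
have scaleDl x : {morph scale^~ x : c d / c + d >-> add c d}.
  move=> c d; have := law (tscale (c + d) (Var _ x))
    (tadd (tscale c (Var _ x)) (tscale d (Var _ x))).
  by rewrite !addE; apply=> V _ a /=; rewrite scalerDl.
clear law TM.
case: M @add @opp @scale @zero addE addA addC add0 addN
  scaleA scale1 scaleD scaleDl => D F R add opp scale zero addE
  addA addC add0 addN scaleA scale1 scaleD scaleDl.
pose Ch : choiceType := HB.pack D (gen_eqMixin D) (gen_choiceMixin D).
pose zmod := GRing.isZmodule.Build Ch addA addC add0 addN.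
pose Z : zmodType := HB.pack Ch zmod.
pose lmod := GRing.Zmodule_isLmodule.Build K Z scaleA scale1 scaleD scaleDl.
pose V : lmodType K := HB.pack Z lmod.
exists V, R; rewrite /vector_structure.
suff -> : F = @vector_interp K V by [].
apply: functional_extensionality_dep => -[|||c]; apply: funext => v /=.
- by congr F; apply: funext => -[].
- rewrite [v]pair_of_eta; congr F; apply: funext => i.
  by rewrite /pair_of; case: eqP.
- by congr F; apply: funext => i; rewrite ord1.
- by congr F; apply: funext => i; rewrite ord1.
Qed.

(** * Extension of a partial form to a total one *)

Section PartialForm.
Variables (V : lmodType K) (R : LK_rel K -> ('I_2 -> V) -> Prop).
Let M : structure (LK K) := vector_structure R.

(** The span of z, described by terms so that a vector in it comes with its
    expression as a linear combination.  The terms have all of V as variables;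
    the second clause says that only those in z matter. *)
Definition formal_span (z : seq V) (v : V) : Prop :=
  exists t : term (LK K) V, eval (M := M) id t = v /\
    forall (W : bilinear_space K) (a : V -> W) (f : {linear V -> W}),
      {in z, f =1 a} -> eval (M := space_structure W) a t = f v.

Lemma formal_span_mem z v : v \in z -> formal_span z v.
Proof. by exists (Var (LK K) v); split=> // W a f ->. Qed.

Lemma formal_span0 z : formal_span z 0.
Proof. by exists (tzero K V); split=> // W a f _; rewrite linear0. Qed.

Lemma formal_span_lin z c u v :
  formal_span z u -> formal_span z v -> formal_span z (c *: u + v).
Proof.
move=> [t [<- Ht]] [s [<- Hs]]; exists (tadd (tscale c t) s).
by split=> // W a f fa; rewrite linearP -(Ht W a f fa) -(Hs W a f fa).
Qed.

Lemma formal_spanZ z c v : formal_span z v -> formal_span z (c *: v).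
Proof.
by move=> zv; rewrite -[_ *: _]addr0; apply/formal_span_lin/formal_span0.
Qed.

Lemma separating_functional z v : ~ formal_span z v ->
  exists phi : {linear V -> K^o}, phi v = 1 /\ {in z, forall u, phi u = 0}.
Proof.
(* The relation sends c v + s to c, for s in the span of z. *)
move=> zv; pose G (u : V) (c : K^o) := formal_span z (u - (c : K) *: v).
have [||phi [Gphi _]] := @linear_extension K V K^o G.
- split=> [|c x y x' y' Gx Gx'].
    by rewrite /G scale0r subrr; apply: formal_span0.
  have shift (d e : K) : c *: x + x' - (c * d + e) *: v =
      c *: (x - d *: v) + (x' - e *: v).
    by rewrite scalerDr scalerN scalerA scalerDl opprD addrACA.
  by rewrite /G [_ - _]shift; apply: formal_span_lin.
- move=> c; rewrite /G sub0r -scaleNr => /(formal_spanZ (- c^-1)).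
  rewrite scalerA mulrNN => H; apply: contrapT => /eqP c0.
  by apply: zv; rewrite mulVf // scale1r in H.
exists phi; split=> [|u zu]; apply: Gphi.
  by rewrite /G scale1r subrr; apply: formal_span0.
by rewrite /G scale0r subr0; apply: formal_span_mem.
Qed.

(** The linear relations between finitely many vectors follow from finitely many
    of them, so one formula expresses that an assignment of these vectors extends
    linearly.  It lists a relation for each vector that depends on those after
    it in z; the other vectors can be sent anywhere, by adding a multiple of a
    separating functional. *)
Lemma finite_presentation (z : seq V) :
  exists p : formula (LK K) V, sat (M := M) id p /\
    forall (W : bilinear_space K) (a : V -> W),
      sat (M := space_structure W) a p ->
      exists f : {linear V -> W}, {in z, f =1 a}.
Proof.
elim: z => [|v z [p [Mp Hp]]].
  by exists (Top _ _); split=> // W a _; exists \0.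
have [[t [tv Ht]]|/separating_functional[phi [phiv phiz]]] :=
    pselect (formal_span z v).
  exists (And p (Equal (Var (LK K) v) t)); split=> [|W a [/Hp[f fa] /= av]].
    by split=> //=; rewrite tv.
  exists f => u; rewrite inE => /predU1P[->|/fa//].
  by rewrite av (Ht W a f fa).
exists p; split=> // W a /Hp[f fa].
have flin : linear (fun x => f x + (phi x : K) *: (a v - f v)).
  move=> c x y.
  have phiD : phi (c *: x + y) = c * (phi x : K) + phi y := linearP phi c x y.
  by rewrite phiD linearP scalerDl [in RHS]scalerDr scalerA addrACA.
exists (linear_map flin) => u; rewrite inE => /predU1P[->|zu] /=.
  by rewrite phiv scale1r addrC subrK.
by rewrite phiz // scale0r addr0 fa.
Qed.

Definition class_form := {B : {biscalar V} | space_class (BilinearSpace B)}.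

Lemma pullback_bilinear (W : bilinear_space K) (f : {linear V -> W}) :
  bilinear_for *%R *%R (fun x y => product W (f x) (f y)).
Proof. by split=> u c x y /=; rewrite linearP ?linearPl ?linearPr. Qed.

Lemma pullback_class (W : bilinear_space K) (f : {linear V -> W}) :
  space_class W ->
  space_class (BilinearSpace (bilinear_form (pullback_bilinear f))).
Proof.
move=> [Ws Wa]; split=> [/Ws|/Wa] H; first by move=> x y; apply: H.
by move=> x; apply: H.
Qed.

Definition pullback W f (CW : space_class W) : class_form :=
  exist (fun B => space_class (BilinearSpace B)) _ (pullback_class f CW).

Definition evaluation (x y : V) : class_form -> K^o := fun B => sval B x y.

Lemma evaluation_linear_l y : linear (evaluation^~ y).
Proof.
by move=> c x x'; apply: funext => -[B CB]; rewrite /evaluation /= linearPl.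
Qed.

Lemma evaluation_linear_r x : linear (evaluation x).
Proof.
by move=> c y y'; apply: funext => -[B CB]; rewrite /evaluation /= linearPr.
Qed.

(** A value is forced by a formula p true in the model, since formulas can be
    conjoined and refuted by the theory.  The quantification over f makes the
    relation linear, while its restriction to finitely many vectors z leaves the
    existence of f to be settled by another formula ([finite_presentation]). *)
Definition forced (u : class_form -> K^o) (l : K^o) : Prop :=
  exists (z : seq V) (p : formula (LK K) V), sat (M := M) id p /\
    forall W (CW : space_class W) (a : V -> W),
      sat (M := space_structure W) a p ->
      forall f : {linear V -> W}, {in z, f =1 a} -> u (pullback f CW) = l.

Lemma forced_linear : linear_relation forced.
Proof.
split=> [|c u l u' l' [z [p [Mp Hp]]] [z' [p' [Mp' Hp']]]].
  by exists [::], (Top _ _).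
exists (z ++ z'), (And p p'); split=> // W CW a [pa pa'] f fa.
rewrite /= -(Hp W CW a pa f) -?(Hp' W CW a pa' f) // => x xz; apply: fa.
  by rewrite mem_cat xz orbT.
by rewrite mem_cat xz.
Qed.

Lemma forced_evaluation l (v : 'I_2 -> V) :
  R (LKform l) v -> forced (evaluation (v ord0) (v ord_max)) l.
Proof.
move=> Rv; exists [:: v ord0; v ord_max].
exists (@Rel (LK K) V (LKform l) (fun i => Var (LK K) (v i))); split=> //.
by move=> W CW a /= pa f fa; rewrite /evaluation /= !fa ?inE ?eqxx ?orbT.
Qed.

Hypothesis TM : model spaces_theory M.

(** If finitely many facts forced the zero function to a nonzero value, no
    space could realise them, and the model would refute their inconsistency. *)
Lemma forced_single_valued : single_valued forced.
Proof.
move=> l [z [p [Mp Hp]]]; apply: contrapT => l0.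
have [q [Mq Hq]] := finite_presentation z.
apply: (model_entails TM (p := And p q) (q := Bot _ _) _ (a := id)) => //=.
by move=> W CW a [pa /Hq[f fa]]; apply: l0; rewrite -(Hp W CW a pa f fa).
Qed.

Lemma model_form :
  exists B : {biscalar V}, space_class (BilinearSpace B) /\
    forall l (v : 'I_2 -> V), R (LKform l) v -> B (v ord0) (v ord_max) = l.
Proof.
have [phi [Gphi _]] := linear_extension forced_linear forced_single_valued.
pose B x y : K := phi (evaluation x y).
have Blin : bilinear_for *%R *%R B.
  split=> [y c x x'|x c y y']; rewrite /B.
    by rewrite evaluation_linear_l linearP.
  by rewrite evaluation_linear_r linearP.
exists (bilinear_form Blin); split=> [|l v /forced_evaluation]; last exact: Gphi.
split=> [syms x y|alts x]; rewrite /= /B.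
  by congr (phi _); apply: funext => -[C [Cs Ca]]; apply: Cs.
rewrite (_ : evaluation x x = 0) ?linear0 //.
by apply: funext => -[C [Cs Ca]]; apply: Ca.
Qed.

Lemma model_neq (v : 'I_2 -> V) : R (LKneq K) v -> v ord0 <> v ord_max.
Proof.
move=> Rv v01.
apply: (model_entails TM (p := And
    (@Rel (LK K) V (LKneq K) (fun i => Var (LK K) (v i)))
    (Equal (Var (LK K) (v ord0)) (Var (LK K) (v ord_max))))
  (q := Bot _ _) _ (a := id)) => //=.
by move=> W CW a [].
Qed.

End PartialForm.

Lemma ec_space (M : structure (LK K)) : existentially_closed spaces_theory M ->
  exists2 V, space_class V & M = space_structure V.
Proof.
move=> [TM ec]; have [V [R MR]] := model_vector_space TM; subst M.
have [B [CB RB]] := model_form TM.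
exists (BilinearSpace B) => //.
have pos : forall (X : Type) (p : formula (LK K) X) (a : X -> V),
    sat (M := vector_structure R) a p ->
    sat (M := space_structure (BilinearSpace B)) a p.
  apply: (@preserves_positive _ (vector_structure R)
            (space_structure (BilinearSpace B)) id); first by case.
  by case=> [|l] v; [apply: (model_neq TM)|apply: RB].
have imm := ec (space_structure (BilinearSpace B)) id (space_model CB)
  (fun n => pos 'I_n).
congr Structure; apply: functional_extensionality_dep => r; apply: funext => v.
pose p := @Rel (LK K) V r (fun i => Var (LK K) (v i)).
apply/propext; split; first exact: (pos _ p id).
exact: (immersion_reflects imm (p := p) (a := id)).
Qed.

(** * Amalgamation of bilinear spaces *)

Lemma isometry_positive (V W : bilinear_space K) (h : {linear V -> W}) :
  injective h -> (forall x y, product W (h x) (h y) = product V x y) ->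
  forall (X : Type) (p : formula (LK K) X) (a : X -> V),
    sat (M := space_structure V) a p -> sat (M := space_structure W) (h \o a) p.
Proof.
move=> hinj hiso.
apply: (@preserves_positive _ (space_structure V) (space_structure W)).
  by case=> [|||c] v /=; rewrite ?linear0 ?linearD ?linearN ?linearZ.
by case=> [v /= v01 /hinj|l v /= <-].
Qed.

(** In the application, f and g are mutually inverse isometries between
    subspaces A of V and B of W, extended by linear maps with values in B and A,
    so that g o f is a projection of V onto A, whose kernel serves as the
    complement of A.  The space V embeds as the pairs (x - g (f x), f x), in which
    the first component lies in this kernel; taking all of V as first factor
    avoids a subspace type.  A vector of W is multiplied with one of V by means
    of its image in A. *)
Section Amalgam.
Variables (V W : bilinear_space K) (f : {linear V -> W}) (g : {linear W -> V}).

Definition amalgam_product (u v : V * W) : K :=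
  product V u.1 v.1 + product V u.1 (g v.2) + product V (g u.2) v.1 +
  product W u.2 v.2.

Lemma amalgam_bilinear : bilinear_for *%R *%R amalgam_product.
Proof.
split=> u c x y; rewrite /amalgam_product /= !linearP.
  by rewrite !linearPl; ring.
by ring.
Qed.

Definition amalgam : bilinear_space K :=
  BilinearSpace (bilinear_form amalgam_bilinear).

Lemma amalgam_class : space_class V -> space_class W -> space_class amalgam.
Proof.
move=> [Vs Va] [Ws Wa]; split=> [sy u v|al u].
  rewrite /= /amalgam_product (Vs sy u.1) (Vs sy u.1) (Vs sy (g u.2)) (Ws sy).
  by ring.
(* The mixed terms cancel because an alternating form is antisymmetric, which is
   seen by expanding the square of u.1 + g u.2. *)
rewrite /= /amalgam_product (Va al) (Wa al) add0r addr0.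
have := Va al (u.1 + g u.2); rewrite linearDl !linearDr (Va al) (Va al).
by rewrite add0r addr0.
Qed.

Lemma inl_linear : linear (fun x : V => (x - g (f x), f x) : amalgam).
Proof.
move=> c x y; congr pair; rewrite /= ?linearP //.
by rewrite scalerDr addrACA.
Qed.

Lemma inr_linear : linear (fun y : W => (0, y) : amalgam).
Proof. by move=> c x y; congr pair; rewrite /= scaler0 addr0. Qed.

Definition amalgam_inl : {linear V -> amalgam} := linear_map inl_linear.
Definition amalgam_inr : {linear W -> amalgam} := linear_map inr_linear.

Lemma amalgam_inl_isometry :
  (forall x y, product W (f x) (f y) = product V (g (f x)) (g (f y))) ->
  forall x y, product amalgam (amalgam_inl x) (amalgam_inl y) = product V x y.
Proof.
move=> f_iso x y; rewrite /= /amalgam_product /= f_iso.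
have -> : product V x y =
    product V (x - g (f x) + g (f x)) (y - g (f y) + g (f y)) by rewrite !subrK.
move: (x - g (f x)) (y - g (f y)) => m n.
by rewrite linearDl !linearDr addrA.
Qed.

Lemma amalgam_inr_isometry x y :
  product amalgam (amalgam_inr x) (amalgam_inr y) = product W x y.
Proof. by rewrite /= /amalgam_product /= !linear0l linear0r !add0r. Qed.

Lemma amalgam_inl_injective : injective amalgam_inl.
Proof. by move=> x y [+ fxy]; rewrite fxy => /addIr. Qed.

Lemma amalgam_inr_injective : injective amalgam_inr.
Proof. by move=> x y []. Qed.

End Amalgam.

(** * Types *)

Lemma qftp_sub_tp V (N : structure (LK K)) (I : Type)
    (a : I -> space_structure V) (b : I -> N) :
  space_class V -> existentially_closed spaces_theory N -> qftp a = qftp b ->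
  (tp a `<=` tp b)%classic.
Proof.
move=> CV ecN; have [W CW NW] := ec_space ecN; subst N => ab.
have qf (p : formula (LK K) I) : quantifier_free p -> sat a p <-> sat b p.
  move=> qfp; have : qftp a p <-> qftp b p by rewrite ab.
  by rewrite /qftp /tp /= => -[h1 h2]; split=> [pa|pb]; [case: h1|case: h2].
pose ea := @eval _ (space_structure V) I a.
pose eb := @eval _ (space_structure W) I b.
have eqab t u : ea t = ea u <-> eb t = eb u := qf (Equal t u) isT.
(* The graph of the isometry between the spans of a and b. *)
pose G x y := exists t, x = ea t /\ y = eb t.
have Glin : linear_relation G.
  split=> [|c x y x' y' [t [-> ->]] [u [-> ->]]]; first by exists (tzero K I).
  by exists (tadd (tscale c t) u).
have Gsv : single_valued G.
  by move=> y [t [t0 ->]]; apply/(eqab t (tzero K I)); rewrite -t0.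
have [f [Gf fG]] := linear_extension Glin Gsv.
have [||g [Gg _]] := @linear_extension _ W V (fun y x => G x y).
- by case: Glin => G0 Gl; split=> // c x y x' y'; apply: Gl.
- by move=> x [t [-> t0]]; apply/(eqab t (tzero K I)); rewrite -t0.
have fE x : exists t, f x = eb t /\ g (f x) = ea t.
  by have [x' [t [_ ft]]] := fG x; exists t; split=> //; apply: Gg; exists t.
have f_iso x y : product W (f x) (f y) = product V (g (f x)) (g (f y)).
  have [[t [-> ->]] [u [-> ->]]] := (fE x, fE y).
  by have := (qf (atom (LKform (product V (ea t) (ea u))) t u) isT).1; apply.
have inl_inr i : amalgam_inl f g (a i) = amalgam_inr g (b i).
  have Gi : G (a i) (b i) by exists (Var (LK K) i).
  by rewrite /= (Gf _ _ Gi) (Gg _ _ Gi) subrr.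
move=> p pa; have [_ ec] := ecN.
have inr_pos :=
  isometry_positive (@amalgam_inr_injective V W g) (amalgam_inr_isometry g).
have imm := ec (space_structure (amalgam g)) _
  (space_model (amalgam_class g CV CW)) (fun n => inr_pos 'I_n).
apply: (immersion_reflects imm).
have := isometry_positive (@amalgam_inl_injective V W f g)
  (amalgam_inl_isometry f_iso) pa.
by congr (sat _ p); apply: funext => i; apply: inl_inr.
Qed.

Lemma qftp_determines_tp (M N : structure (LK K)) :
  existentially_closed spaces_theory M -> existentially_closed spaces_theory N ->
  forall (I : Type) (a : I -> M) (b : I -> N), qftp a = qftp b -> tp a = tp b.
Proof.
move=> ecM ecN I a b ab.
have [[V CV MV] [W CW NW]] := (ec_space ecM, ec_space ecN); subst M N.
apply/seteqP; split; first exact: qftp_sub_tp ab.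
by apply: qftp_sub_tp => //; rewrite ab.
Qed.

End Spaces.

Theorem theorem4p9 (K : fieldType) (T : theory (LK K)) :
  [\/ T = TK K, T = TKs K | T = TKa K] ->
  forall M N : structure (LK K),
    existentially_closed T M -> existentially_closed T N ->
    forall (I : Type) (a : I -> M) (b : I -> N),
      qftp a = qftp b -> tp a = tp b.
Proof.
move=> TE; suff [sy [al ->]] : exists sy al, T = @spaces_theory K sy al.
  exact: qftp_determines_tp.
case: TE => ->; [exists false, false|exists true, false|exists false, true].
- by apply/seteqP; split=> s Ts V; [move=> _|]; apply: Ts.
- apply/seteqP; split=> s Ts V; last by move=> Vs; apply: Ts.
  by case=> Vs _; apply: Ts; apply: Vs.
- apply/seteqP; split=> s Ts V; last by move=> Va; apply: Ts.
  by case=> _ Va; apply: Ts; apply: Va.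
Qed.
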